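(* Let $\pi^*$ be an optimal feasible policy and let $\mathbf{y}$ be the output of the continuous greedy procedure described in the context. Then the expected utility of \textsf{StoCan} (which flips a fair coin and runs $\pi^{small}$ or $\pi^{large}$ accordingly), namely $\tfrac12\big(f(\pi^{small})+f(\pi^{large})\big)$, is at least $\frac{1-1/e}{16}\,f(\pi^* )$.
   Context: Let $I,S$ be positive integers, $[I]=\{1,\dots,I\}$ a set of items and $[S]=\{1,\dots,S\}$ a set of states. For $u,v\in\{0,1,\dots,S\}^{[I]}$ write $u\le v$ coordinatewise, $(u\vee v)(i)=\max\{u(i),v(i)\}$, and let $\mathbf{1}_i$ be the $i$-th unit vector. Let $f:\{0,1,\dots,S\}^{[I]}\to\mathbb{R}_{\ge 0}$ be monotone ($u\le v\Rightarrow f(u)\le f(v)$) and lattice submodular ($f(u\vee s\mathbf{1}_i)-f(u)\ge f(v\vee s\mathbf{1}_i)-f(v)$ for all $u\le v$, $s\in[S]$, $i\in[I]$). The states $\phi(i)\in[S]$ of the items are independent random variables with known distributions $p_i(s)=\Pr[\phi(i)=s]$. Each item $i$ in state $s$ has a cost $c_i(s)\ge 0$, with $c_i(s)\ge c_i(s')$ whenever $s\ge s'$. A budget $B>0$ is given. For $U\subseteq[I]\times[S]$ define $h(U)=f(u)$ where $u(i)=\max\{s:(i,s)\in U\}$ if some $(i,s)\in U$ and $u(i)=0$ otherwise. For $\mathbf{x}\in[0,1]^{[I]\times[S]}$ define the multilinear extension $H(\mathbf{x})=\sum_{U\subseteq[I]\times[S]} h(U)\prod_{(i,s)\in U}x_{is}\prod_{(i,s)\notin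 U}(1-x_{is})$, i.e. the expectation of $h(R)$ where $R$ contains each $(i,s)$ independently with probability $x_{is}$. A (deterministic) policy sequentially and adaptively chooses an item to probe based on observations so far; probing item $i$ reveals $\phi(i)$, after which the policy must immediately and irrevocably decide whether to pick $(i,\phi(i))$; only probed items can be picked. For a realization $\zeta$ of $\phi$, let $G(\pi,\zeta)\subseteq[I]\times[S]$ be the set of picked item-state pairs. The policy is feasible if $\sum_{(i,s)\in G(\pi,\zeta)}c_i(s)\le B$ for every $\zeta$, and its expected utility is $f(\pi)=\mathbb{E}_\phi[h(G(\pi,\phi))]$. $\pi^*$ denotes a feasible policy maximizing $f(\pi)$. Continuous greedy: set $\delta=1/(IS)^2$, $\mathbf{y}(0)=\mathbf{0}$. For $t=0,\delta,2\delta,\dots,1-\delta$: let $R(t)$ contain each $(i,s)$ independently with probability $y_{is}(t)$; set $\omega_{is}=\mathbb{E}[h(R(t)\cup\{(i,s)\})]-\mathbb{E}[h(R(t))]$; let $\mathbf{x}^{LP}$ be an optimal solution of the LP: maximize $\sum_{(i,s)}\omega_{is}x_{is}$ subject to $0\le x_{is}\le p_i(s)$ for all $(i,s)$ and $\sum_{(i,s)}x_{is}c_i(s)\le B$; set $\mathbf{y}(t+\delta)=\mathbf{y}(t)+\delta\,\mathbf{x}^{LP}$. Output $\mathbf{y}=\mathbf{y}(1)$. Policy $\pi^{small}$: start with $G=\emptyset$; for $i=1,\dots,I$: probe $i$ and observe $s=\phi(i)$; if $c_i(s)>B/2$ discard $i$; otherwise, if $B-\sum_{(j,s')\in G}c_j(s')\ge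 c_i(s)$, add $(i,s)$ to $G$ with probability $y_{is}/(4p_i(s))$ (independent randomness). Return $G$. Policy $\pi^{large}$ is identical except that it discards $i$ when $c_i(s)\le B/2$ and considers adding $(i,s)$ when $c_i(s)>B/2$. For these randomized policies, $f(\pi^{small})$, $f(\pi^{large})$ denote $\mathbb{E}[h(G)]$ over both $\phi$ and the internal randomness.
   Formalization: The formal theorem adds the assumption that c_i(s) ≤ B whenever p_i(s) > 0; without it the claim fails, e.g. for I=2, S=1, B=1, f(u)=100u(1)+u(2), costs c_1=2, c_2=1, where StoCan earns 0 but the optimum is 1. *)

(* Defs.v *)
From HB Require Import structures.
From mathcomp Require Import all_boot all_order all_algebra.
From mathcomp Require Import reals.

Set Implicit Arguments.
Unset Strict Implicit.
Unset Printing Implicit Defensive.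

Import Order.TTheory GRing.Theory Num.Theory.

Local Open Scope ring_scope.

(* Items [I] are 'I_n.  States [S] = {1,...,S} are 'I_m, where s : 'I_m       *)
(* stands for the state s.+1; {0,1,...,S} is 'I_m.+1, and [level] is the      *)
(* inclusion of [S] into {0,1,...,S}.                                         *)

Definition level (m : nat) (s : 'I_m) : 'I_m.+1 := lift ord0 s.

Definition state_vec (n m : nat) := {ffun 'I_n -> 'I_m.+1}.

Definition vle (n m : nat) (u v : state_vec n m) : Prop :=
  forall i, (u i <= v i)%N.

Definition vjoin (n m : nat) (u v : state_vec n m) : state_vec n m :=
  [ffun i => Order.max (u i) (v i)].

(* s 1_i *)
Definition vsingle (n m : nat) (i : 'I_n) (s : 'I_m) : state_vec n m :=
  [ffun j => if j == i then level s else ord0].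

Definition monotone (R : realType) (n m : nat) (f : state_vec n m -> R) : Prop :=
  forall u v, vle u v -> f u <= f v.

Definition lattice_submodular (R : realType) (n m : nat)
    (f : state_vec n m -> R) : Prop :=
  forall (u v : state_vec n m) (s : 'I_m) (i : 'I_n), vle u v ->
    f (vjoin v (vsingle i s)) - f v <= f (vjoin u (vsingle i s)) - f u.

Definition is_distribution (R : realType) (m : nat) (q : 'I_m -> R) : Prop :=
  (forall s, 0 <= q s) /\ \sum_s q s = 1.

Definition vec_of_set (n m : nat) (U : {set 'I_n * 'I_m}) : state_vec n m :=
  [ffun i => \big[Order.max/ord0]_(s | (i, s) \in U) level s].

Definition set_utility (R : realType) (n m : nat) (f : state_vec n m -> R)
    (U : {set 'I_n * 'I_m}) : R := f (vec_of_set U).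

(* E[g(R)] for the random set R containing each e : T independently with      *)
(* probability x e.                                                           *)
Definition expect_indep (R : realType) (T : finType) (x : T -> R)
    (g : {set T} -> R) : R :=
  \sum_(U : {set T}) g U * \prod_(e in U) x e * \prod_(e in ~: U) (1 - x e).

Definition multilinear_ext (R : realType) (n m : nat) (f : state_vec n m -> R)
    (x : {ffun 'I_n * 'I_m -> R}) : R := expect_indep x (set_utility f).

Definition expect_state (R : realType) (n m : nat) (p : 'I_n -> 'I_m -> R)
    (g : {ffun 'I_n -> 'I_m} -> R) : R :=
  \sum_(z : {ffun 'I_n -> 'I_m}) (\prod_i p i (z i)) * g z.

Definition set_cost (R : realType) (n m : nat) (c : 'I_n -> 'I_m -> R)
    (U : {set 'I_n * 'I_m}) : R := \sum_(e in U) c e.1 e.2.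

(* A deterministic adaptive policy is a decision tree: [Probe i pick next]    *)
(* probes i, picks (i, s) on observing s iff [pick s], and goes on as         *)
(* [next s].  The branch taken so far records all observations.               *)
Inductive policy (n m : nat) : Type :=
| Stop
| Probe of 'I_n & ('I_m -> bool) & ('I_m -> policy n m).
Arguments Stop {n m}.

(* No item is probed twice on a branch, nor is any item of A probed: a second *)
(* probe of i would allow the irrevocable decision about i to be revised.     *)
Fixpoint probes_once (n m : nat) (A : {set 'I_n}) (pi : policy n m) : Prop :=
  match pi with
  | Stop => True
  | Probe i _ next => i \notin A /\ forall s, probes_once (i |: A) (next s)
  end.

Fixpoint picked (n m : nat) (pi : policy n m) (z : {ffun 'I_n -> 'I_m}) :
    {set 'I_n * 'I_m} :=
  match pi with
  | Stop => set0
  | Probe i pick next =>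
      (if pick (z i) then [set (i, z i)] else set0) :|: picked (next (z i)) z
  end.

Definition feasible (R : realType) (n m : nat) (c : 'I_n -> 'I_m -> R) (B : R)
    (pi : policy n m) : Prop :=
  probes_once set0 pi /\ forall z, set_cost c (picked pi z) <= B.

Definition policy_utility (R : realType) (n m : nat) (f : state_vec n m -> R)
    (p : 'I_n -> 'I_m -> R) (pi : policy n m) : R :=
  expect_state p (fun z => set_utility f (picked pi z)).

Definition optimal_policy (R : realType) (n m : nat) (f : state_vec n m -> R)
    (p c : 'I_n -> 'I_m -> R) (B : R) (pi : policy n m) : Prop :=
  feasible c B pi /\
  forall pi', feasible c B pi' -> policy_utility f p pi' <= policy_utility f p pi.

Definition marginal (R : realType) (n m : nat) (f : state_vec n m -> R)
    (y : {ffun 'I_n * 'I_m -> R}) (e : 'I_n * 'I_m) : R :=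
  expect_indep y (fun U => set_utility f (U :|: [set e])) -
  multilinear_ext f y.

Definition lp_feasible (R : realType) (n m : nat) (p c : 'I_n -> 'I_m -> R)
    (B : R) (x : {ffun 'I_n * 'I_m -> R}) : Prop :=
  (forall e, 0 <= x e <= p e.1 e.2) /\ \sum_e x e * c e.1 e.2 <= B.

Definition lp_optimal (R : realType) (n m : nat) (p c : 'I_n -> 'I_m -> R)
    (B : R) (w : 'I_n * 'I_m -> R) (x : {ffun 'I_n * 'I_m -> R}) : Prop :=
  lp_feasible p c B x /\
  forall x', lp_feasible p c B x' -> \sum_e w e * x' e <= \sum_e w e * x e.

(* Y k is y(k delta) with delta = 1/(IS)^2, so the output y(1) is             *)
(* Y ((IS)^2).  Any optimal LP solution may be used at each step.             *)
Definition continuous_greedy_output (R : realType) (n m : nat)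
    (f : state_vec n m -> R) (p c : 'I_n -> 'I_m -> R) (B : R)
    (y : {ffun 'I_n * 'I_m -> R}) : Prop :=
  let N := ((n * m) ^ 2)%N in
  let delta : R := 1 / N%:R in
  exists Y : nat -> {ffun 'I_n * 'I_m -> R},
    [/\ forall e, Y 0%N e = 0,
        forall k, (k < N)%N ->
          exists2 x, lp_optimal p c B (marginal f (Y k)) x
                   & forall e, Y k.+1 e = Y k e + delta * x e
      & y = Y N].

(* The set G returned when the states are z and the internal coins are given  *)
(* by C: the coin of (i, s) comes up "add" iff (i, s) \in C.  An item i whose *)
(* observed pair fails [keep] is discarded.                                   *)
Definition threshold_run (R : realType) (n m : nat) (c : 'I_n -> 'I_m -> R)
    (B : R) (keep : 'I_n * 'I_m -> bool) (z : {ffun 'I_n -> 'I_m})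
    (C : {set 'I_n * 'I_m}) : {set 'I_n * 'I_m} :=
  foldl (fun G i =>
           if [&& keep (i, z i), c i (z i) <= B - set_cost c G & (i, z i) \in C]
           then (i, z i) |: G else G)
        set0 (enum 'I_n).

(* The coins are independent of each other and of the states.  If p i s = 0   *)
(* the bias of the coin of (i, s) is 0 by the convention x / 0 = 0; that coin *)
(* is used with probability 0.                                                *)
Definition threshold_utility (R : realType) (n m : nat) (f : state_vec n m -> R)
    (p c : 'I_n -> 'I_m -> R) (B : R) (y : {ffun 'I_n * 'I_m -> R})
    (keep : 'I_n * 'I_m -> bool) : R :=
  expect_state p (fun z =>
    expect_indep (fun e => y e / (4 * p e.1 e.2))
      (fun C => set_utility f (threshold_run c B keep z C))).

Definition small_utility (R : realType) (n m : nat) (f : state_vec n m -> R)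
    (p c : 'I_n -> 'I_m -> R) (B : R) (y : {ffun 'I_n * 'I_m -> R}) : R :=
  threshold_utility f p c B y (fun e => c e.1 e.2 <= B / 2).

Definition large_utility (R : realType) (n m : nat) (f : state_vec n m -> R)
    (p c : 'I_n -> 'I_m -> R) (B : R) (y : {ffun 'I_n * 'I_m -> R}) : R :=
  threshold_utility f p c B y (fun e => B / 2 < c e.1 e.2).

(* Main.v *)
(* Every LP optimum is worth at least OPT - H(y), since the probabilities with
   which an adaptive policy picks the pairs are LP-feasible.  Write
   Q_k = 4 H(y(k delta) / 4); then H(y) <= Q by concavity of H along nonnegative
   directions.  Tracking Q_k instead of H(y(k delta)) is what gives the exact
   constant 1 - 1/e in spite of the step size: the increment
   of Q is governed by the gradient of H near y / 4 <= y, which dominates the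
   gradient at y used by the LP, except for pairs that have received little
   weight so far.  The total loss from these pairs is at most
   delta * n / 4, and it is absorbed by the gap between (1 - delta)^(1/delta) and 1/e.

   In the rounding, each candidate is kept with probability y / (4 p), so by a
   Markov bound the picks of a threshold policy exceed B / 2 with probability at
   most 1/2.  Until then every candidate fits; hence each policy earns at
   least half the value of its independent candidates, and the two candidate
   sets together are worth at least H(y / 4) = Q / 4 by subadditivity. *)
Require Import Defs.
From mathcomp Require Import all_boot all_order all_algebra.
From mathcomp Require Import reals topology normedtype derive sequences exp.
From mathcomp Require Import ring lra.
Import Order.TTheory GRing.Theory Num.Theory.
Local Open Scope ring_scope.

Set Implicit Arguments.
Unset Strict Implicit.
Unset Printing Implicit Defensive.

(** * A second-order bound on the exponential *)

Section ExpBound.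
Import numFieldNormedType.Exports.

(** The function [(1 - t) * expR (t + t ^+ 2 / 2)] is 1 at 0 and has derivative
    [- (t ^+ 2 * expR (t + t ^+ 2 / 2))], so it is nonincreasing. The quadratic term, absent from
    [1 - u <= expR (- u)], is the slack that later pays for the finite step size. *)
Lemma oneB_le_expR (R : realType) (u : R) : 0 <= u ->
  1 - u <= expR (- (u + u ^+ 2 / 2)).
Proof.
rewrite le_eqVlt => /orP[/eqP <-|u0].
  by rewrite subr0 expr0n mul0r addr0 oppr0 expR0.
pose F (t : R) := (1 - t) * expR (t + t ^+ 2 / 2).
pose F' (t : R) := - (t ^+ 2 * expR (t + t ^+ 2 / 2)).
have dF (t : R) : is_derive t 1 F (F' t).
  rewrite /F; apply: is_derive_eq.
  by rewrite /F' /GRing.scale /=; field.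
have [|t _] := @MVT R F F' _ _ u0 (fun t _ => dF t).
  by apply: derivable_within_continuous => t _; case: (dF t).
rewrite /F expr0n mul0r addr0 expR0 mulr1 subr0 subr0 => Fu.
rewrite expRN -[_^-1]mul1r ler_pdivlMr ?expR_gt0 // -subr_le0 Fu.
rewrite /F' mulNr oppr_le0; apply: mulr_ge0; last exact: ltW.
by apply: mulr_ge0; [exact: sqr_ge0 | exact: expR_ge0].
Qed.

End ExpBound.

(** * Expectations over random sets with independent elements *)

Section IndependentSets.
Variables (R : realType) (T : finType).
Implicit Types (x y : T -> R) (g h : {set T} -> R) (U V A : {set T}) (e : T).

(** For [e \notin U], the probability that the random set agrees with [U] outside [e]. *)
Let weight x e U : R :=
  (\prod_(e' in U) x e') * \prod_(e' in ~: U :\ e) (1 - x e').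

Let expect_indep_coord x g e :
  expect_indep x g = \sum_(U : {set T} | e \notin U)
     weight x e U * ((1 - x e) * g U + x e * g (e |: U)).
Proof.
rewrite /expect_indep (bigID (fun U : {set T} => e \notin U)) /=.
rewrite [X in _ + X](reindex_onto (fun U => e |: U) (fun U => U :\ e)) /=; last first.
  by move=> U; rewrite negbK => /setD1K.
rewrite [X in _ + X](eq_bigl (fun U : {set T} => e \notin U)); last first.
  move=> U; rewrite negbK setU11 /=; apply/eqP/idP => [<-|]; last exact: setU1K.
  by rewrite setD11.
rewrite -big_split /=; apply: eq_bigr => U eU.
rewrite big_setU1 //= /weight (big_setD1 e (A := ~: U)) ?inE //=.
rewrite (_ : ~: (e |: U) = ~: U :\ e); last first.
  by apply/setP => e'; rewrite !inE negb_or.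
ring.
Qed.

Lemma expect_indep_split x g e :
  expect_indep x g = x e * expect_indep x (fun U => g (e |: U)) +
                     (1 - x e) * expect_indep x (fun U => g (U :\ e)).
Proof.
rewrite !(expect_indep_coord _ _ e) !mulr_sumr -big_split /=.
apply: eq_bigr => U eU; rewrite setUA setUid setU1K //.
have -> : U :\ e = U by apply/setDidPl; rewrite disjoint_sym disjoints1.
ring.
Qed.

Lemma eq_expect_indep_off x y g e :
  (forall e', e' != e -> x e' = y e') ->
  (forall U, g (e |: U) = g (U :\ e)) ->
  expect_indep x g = expect_indep y g.
Proof.
move=> xy gE; rewrite !(expect_indep_coord _ _ e); apply: eq_bigr => U eU.
have Ue : U :\ e = U by apply/setDidPl; rewrite disjoint_sym disjoints1.
rewrite gE Ue -!mulrDl !subrK; congr (_ * _ * _); apply: eq_bigr => e' e'U.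
  by apply: xy; apply: contraNneq eU => <-.
by rewrite xy //; move: e'U; rewrite !inE => /andP[].
Qed.

Lemma eq_expect_indep x y g h : x =1 y -> g =1 h ->
  expect_indep x g = expect_indep y h.
Proof.
move=> xy gh; apply: eq_bigr => U _.
by rewrite gh; congr (_ * _ * _); apply: eq_bigr => e _; rewrite xy.
Qed.

Lemma expect_indepD x g h :
  expect_indep x (fun U => g U + h U) = expect_indep x g + expect_indep x h.
Proof. by rewrite -big_split; apply: eq_bigr => U _; rewrite /= !mulrDl. Qed.

Lemma expect_indepZ x (k : R) g :
  expect_indep x (fun U => k * g U) = k * expect_indep x g.
Proof. by rewrite /expect_indep mulr_sumr; apply: eq_bigr => U _; rewrite !mulrA. Qed.

Lemma expect_indepB x g h :
  expect_indep x (fun U => g U - h U) = expect_indep x g - expect_indep x h.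
Proof.
rewrite -[RHS]/(_ + - _) -mulN1r -expect_indepZ -expect_indepD.
by apply: eq_expect_indep => // U; rewrite mulN1r.
Qed.

Lemma expect_indep_sum (J : finType) x (g : J -> {set T} -> R) :
  expect_indep x (fun U => \sum_j g j U) = \sum_j expect_indep x (g j).
Proof.
rewrite /expect_indep exchange_big; apply: eq_bigr => U _ /=.
by rewrite !mulr_suml.
Qed.

Lemma expect_indep_cst x (k : R) : expect_indep x (fun=> k) = k.
Proof.
transitivity (k * \prod_(e : T) (x e + (1 - x e))); last first.
  by rewrite big1 ?mulr1 // => e _; rewrite addrC subrK.
rewrite bigA_distr mulr_sumr; apply: eq_bigr => U _; rewrite -mulrA; congr (_ * _).
rewrite [RHS](bigID (mem U)) /=; congr (_ * _).
  by apply: eq_bigr => e ->.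
by apply: eq_big => e; rewrite inE // => /negPf ->.
Qed.

Definition prob_vec x := forall e, 0 <= x e <= 1.

Lemma expect_indep_weight_ge0 x U : prob_vec x ->
  0 <= (\prod_(e in U) x e) * \prod_(e in ~: U) (1 - x e).
Proof.
move=> x01; apply: mulr_ge0; apply: prodr_ge0 => e _; have /andP[] := x01 e => //.
by rewrite subr_ge0.
Qed.

Lemma le_expect_indep x g h : prob_vec x -> (forall U, g U <= h U) ->
  expect_indep x g <= expect_indep x h.
Proof.
move=> x01 gh; apply: ler_sum => U _; rewrite -!mulrA; apply: ler_wpM2r => //.
exact: expect_indep_weight_ge0.
Qed.

Lemma expect_indep_ge0 x g : prob_vec x -> (forall U, 0 <= g U) ->
  0 <= expect_indep x g.
Proof. by move=> x01 g0; rewrite -(expect_indep_cst x 0); apply: le_expect_indep. Qed.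

(** When [g] ignores [e], its value is independent of the event [e \in U]. *)
Lemma expect_indep_mem_mul x g e : (forall U, g (e |: U) = g (U :\ e)) ->
  expect_indep x (fun U => (e \in U)%:R * g U) = x e * expect_indep x g.
Proof.
move=> gE; rewrite (expect_indep_split _ _ e).
rewrite (eq_expect_indep (h := fun U => g (e |: U)) (y := x)) => // [|U]; last first.
  by rewrite setU11 mul1r.
rewrite [X in _ + _ * X](eq_expect_indep (h := fun=> 0) (y := x)) => // [|U]; last first.
  by rewrite setD11 mul0r.
rewrite expect_indep_cst mulr0 addr0 [expect_indep x g](expect_indep_split _ _ e).
rewrite [X in _ = x e * (_ + _ * X)](eq_expect_indep (h := fun U => g (e |: U)) (y := x)) //.
by rewrite -mulrDl addrC subrK mul1r.
Qed.

(** A change of measure, factor by factor: each [U] has under [y] at least [\prod_e (1 - d e)] times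
    its probability under [x]. *)
Lemma ler_expect_indep_scale x y (d : T -> R) g :
  prob_vec x -> (forall e, 0 <= d e <= 1) ->
  (forall e, (1 - d e) * x e <= y e) ->
  (forall e, (1 - d e) * (1 - x e) <= 1 - y e) ->
  (forall U, 0 <= g U) ->
  (\prod_e (1 - d e)) * expect_indep x g <= expect_indep y g.
Proof.
move=> x01 d01 dx dx' g0; rewrite /expect_indep mulr_sumr; apply: ler_sum => U _.
rewrite -!mulrA mulrCA; apply: ler_wpM2l => //.
rewrite [X in X * _ <= _](bigID (mem U)) /=.
rewrite [X in _ * X * _](eq_bigl (mem (~: U))); last by move=> e; rewrite !inE.
rewrite mulrACA -!big_split /=.
have d1 e : 0 <= 1 - d e by have /andP[_] := d01 e; rewrite subr_ge0.
have x0 e : 0 <= x e by have /andP[] := x01 e.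
have x1 e : 0 <= 1 - x e by have /andP[_] := x01 e; rewrite subr_ge0.
apply: ler_pM; first by apply: prodr_ge0 => e _; apply: mulr_ge0.
- by apply: prodr_ge0 => e _; apply: mulr_ge0.
- by apply: ler_prod => e _; rewrite mulr_ge0 /=.
- by apply: ler_prod => e _; rewrite mulr_ge0 /=.
Qed.

Lemma prod_1B_ge (d : T -> R) : (forall e, 0 <= d e <= 1) ->
  1 - \sum_e d e <= \prod_e (1 - d e).
Proof.
(* The induction needs the partial products to stay in [[0, 1]]. *)
move=> d01; suff: 0 <= \prod_e (1 - d e) <= 1 /\ 1 - \sum_e d e <= \prod_e (1 - d e).
  by case.
elim/big_rec2: _ => [|e P S _ [/andP[P0 P1] PS]]; first by rewrite subr0 lexx ler01.
have /andP[d0 d1] := d01 e.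
split; first by rewrite mulr_ge0 ?subr_ge0 //= mulr_ile1 ?subr_ge0 // gerBl.
nra.
Qed.

End IndependentSets.

(** * Multilinear extensions of monotone submodular set functions *)

Section SubmodularSets.
Variables (R : realType) (T : finType).
Implicit Types (x y : T -> R) (g : {set T} -> R) (A B U : {set T}) (e : T).

(** Removing [e] from the subtrahend makes this independent of whether [e \in U], so its expectation
    is the partial derivative of the multilinear extension in direction [e]. *)
Definition gain g e U : R := g (e |: U) - g (U :\ e).

Lemma expect_indep_diff x y g e : (forall e', e' != e -> x e' = y e') ->
  expect_indep y g - expect_indep x g = (y e - x e) * expect_indep x (gain g e).
Proof.
move=> xy; have yx e' : e' != e -> y e' = x e' by move/xy.
rewrite (expect_indep_split y g e) (expect_indep_split x g e) expect_indepB.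
rewrite (eq_expect_indep_off (g := fun U => g (e |: U)) yx); last first.
  by move=> U; congr g; apply/setP => e'; rewrite !inE; case: eqP.
rewrite (eq_expect_indep_off (g := fun U => g (U :\ e)) yx); last first.
  by move=> U; congr g; apply/setP => e'; rewrite !inE; case: eqP.
ring.
Qed.

(** Coordinates are moved from [x] to [y] one at a time: the extension is affine in each of them,
    and every hybrid vector lies between [x] and [y]. *)
Lemma expect_indep_telescope x y g (b : T -> R) :
  (forall e, x e <= y e) ->
  (forall e z, (forall e', x e' <= z e' <= y e') -> b e <= expect_indep z (gain g e)) ->
  \sum_e (y e - x e) * b e <= expect_indep y g - expect_indep x g.
Proof.
move=> xy bP; pose hyb (s : seq T) e := if e \in s then y e else x e.
have H (s : seq T) : uniq s ->
    \sum_(e <- s) (y e - x e) * b e <= expect_indep (hyb s) g - expect_indep x g.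
  elim: s => [|e s IH] /=; first by rewrite big_nil subrr.
  case/andP=> es us; rewrite big_cons.
  rewrite -(subrK (expect_indep (hyb s) g) (expect_indep (hyb (e :: s)) g)) -addrA.
  apply: lerD (IH us); rewrite (@expect_indep_diff (hyb s) _ _ e); last first.
    by move=> e' e'e; rewrite /hyb inE (negPf e'e).
  rewrite /hyb inE eqxx /= (negPf es); apply: ler_wpM2l; first by rewrite subr_ge0.
  by apply: bP => e'; case: ifP => _; rewrite lexx xy.
have := H (index_enum T) (index_enum_uniq T); rewrite (eq_expect_indep (y := y) (h := g)) //.
by move=> e; rewrite /hyb mem_index_enum.
Qed.

Lemma prob_vec_between x y z : prob_vec x -> prob_vec y ->
  (forall e, x e <= z e <= y e) -> prob_vec z.
Proof.
move=> x01 y01 xzy e; have /andP[x0 _] := x01 e; have /andP[_ y1] := y01 e.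
by have /andP[xz zy] := xzy e; rewrite (le_trans x0) //= (le_trans zy).
Qed.

Lemma expect_indep_le x y g : prob_vec x -> prob_vec y -> (forall e, x e <= y e) ->
  (forall A B, A \subset B -> g A <= g B) -> expect_indep x g <= expect_indep y g.
Proof.
move=> x01 y01 xy gle; rewrite -subr_ge0.
have := @expect_indep_telescope x y g (fun=> 0) xy.
rewrite big1; last by move=> e _; rewrite mulr0.
apply=> e z xzy; apply: expect_indep_ge0 => [|U]; first exact: prob_vec_between xzy.
rewrite /gain subr_ge0; apply: gle; apply: (subset_trans (subD1set _ _)).
exact: subsetUr.
Qed.

Variable h : {set T} -> R.
Hypothesis h_ge0 : forall U, 0 <= h U.
Hypothesis h_mono : forall A B, A \subset B -> h A <= h B.
Hypothesis h_submod : forall A B e, A \subset B ->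
  h (e |: B) - h B <= h (e |: A) - h A.

Lemma submod_setU A B C : A \subset B -> h (B :|: C) - h B <= h (A :|: C) - h A.
Proof.
move=> AB; rewrite -(set_enum C); elim: (enum C) => [|e s IH].
  by rewrite set_nil !setU0 !subrr.
rewrite set_cons !(setUCA _ [set e]).
have := @h_submod (A :|: [set e in s]) (B :|: [set e in s]) e (setSU _ AB).
move: IH; lra.
Qed.

Lemma submod_subadd A B : h (A :|: B) <= h A + h B.
Proof. by have := @submod_setU _ _ B (sub0set A); have := h_ge0 set0; rewrite set0U; lra. Qed.

Lemma submod_setU_sum A B : h (A :|: B) <= h A + \sum_(e in B) (h (e |: A) - h A).
Proof.
rewrite -{1}(set_enum B) -big_enum; elim: (enum B) => [|e s IH].
  by rewrite set_nil setU0 big_nil addr0.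
rewrite set_cons (setUCA _ [set e]) big_cons /=.
have := @h_submod A (A :|: [set e in s]) e (subsetUl _ _).
move: IH; lra.
Qed.

Lemma gain_ge0 e U : 0 <= gain h e U.
Proof.
rewrite subr_ge0; apply: h_mono; apply: (subset_trans (subD1set _ _)).
exact: subsetUr.
Qed.

Lemma gain_anti e A B : A \subset B -> gain h e B <= gain h e A.
Proof.
move=> AB; have eD U : e |: U = e |: (U :\ e).
  by apply/setP => e'; rewrite !inE; case: eqP.
by rewrite /gain (eD A) (eD B); apply: h_submod; apply: setSD.
Qed.

Lemma expect_gain_anti x y e : prob_vec x -> prob_vec y -> (forall e', x e' <= y e') ->
  expect_indep y (gain h e) <= expect_indep x (gain h e).
Proof.
move=> x01 y01 xy.
have := @expect_indep_le x y (fun U => -1 * gain h e U) x01 y01 xy.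
rewrite !expect_indepZ !mulN1r lerN2; apply=> A B AB.
by rewrite !mulN1r lerN2; apply: gain_anti.
Qed.

(** Gains are antitone, so between [x] and [y] the gradient is smallest at [y]. *)
Lemma multilinear_diff_ge x y : prob_vec x -> prob_vec y -> (forall e, x e <= y e) ->
  \sum_e (y e - x e) * expect_indep y (gain h e) <= expect_indep y h - expect_indep x h.
Proof.
move=> x01 y01 xy; apply: expect_indep_telescope => // e z xzy.
apply: expect_gain_anti => //; first exact: prob_vec_between xzy.
by move=> e'; case/andP: (xzy e').
Qed.

Lemma multilinear_diff_le x y : prob_vec x -> prob_vec y -> (forall e, x e <= y e) ->
  expect_indep y h - expect_indep x h <= \sum_e (y e - x e) * expect_indep x (gain h e).
Proof.
move=> x01 y01 xy.
(* The telescoped lower bound for [- h] is an upper bound for [h]. *)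
have := @expect_indep_telescope x y (fun U => -1 * h U)
  (fun e => -1 * expect_indep x (gain h e)) xy.
rewrite !expect_indepZ -mulrBr; under eq_bigr do rewrite mulrCA.
rewrite -mulr_sumr !mulN1r lerN2; apply=> e z xzy.
have -> : expect_indep z (gain (fun U => -1 * h U) e) = -1 * expect_indep z (gain h e).
  by rewrite -expect_indepZ; apply: eq_expect_indep => // U; rewrite mulrBr.
rewrite !mulN1r lerN2; apply: expect_gain_anti => //; first exact: prob_vec_between xzy.
by move=> e'; case/andP: (xzy e').
Qed.

(** Concavity on the ray from 0: for [w = y / 4], the gradient at [w] bounds the rise from [w] to
    [y] by three times the rise from 0 to [w]. *)
Lemma multilinear_quarter y : prob_vec y ->
  expect_indep y h <= 4 * expect_indep (fun e => y e / 4) h.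
Proof.
move=> y01; pose w e := y e / 4.
have w01 : prob_vec w by move=> e; have := y01 e; rewrite /w; lra.
have wy e : w e <= y e by have := y01 e; rewrite /w; lra.
have o01 : prob_vec (fun _ : T => 0 : R) by move=> e /=; apply/andP; split.
have ow e : 0 <= w e by have := y01 e; rewrite /w; lra.
have := multilinear_diff_le w01 y01 wy.
have := multilinear_diff_ge o01 w01 ow.
under eq_bigr do rewrite subr0.
have -> : \sum_e (y e - w e) * expect_indep w (gain h e) =
    3 * \sum_e w e * expect_indep w (gain h e).
  by rewrite mulr_sumr; apply: eq_bigr => e _; rewrite /w; field.
have := expect_indep_ge0 o01 h_ge0; rewrite -/w; lra.
Qed.

(* The vector [v] of the proof dominates [(y + a) / 4] and describes the union
   of the random set of [y] with an independent one, of marginals [d], that is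
   empty with probability at least [1 - \sum_e d e]. *)
Lemma quarter_step y (a : T -> R) : prob_vec y -> (forall e, 0 <= a e) ->
  prob_vec (fun e => y e + a e) ->
  (1 - \sum_e Num.max 0 (a e - y e) / 4) * \sum_e a e * expect_indep y (gain h e) <=
  4 * expect_indep (fun e => (y e + a e) / 4) h - 4 * expect_indep (fun e => y e / 4) h.
Proof.
move=> y01 a0 ya01; pose d e := Num.max 0 (a e - y e) / 4.
pose w e := (y e + a e) / 4; pose v e := y e + d e * (1 - y e).
have dcase e : d e = 0 /\ a e <= y e \/ d e = (a e - y e) / 4 /\ y e <= a e.
  by rewrite /d; case: (leP (a e - y e) 0); [left; rewrite mul0r|right]; split=> //; lra.
have a1 e : a e <= 1 by have /andP[] := ya01 e; have /andP[] := y01 e; lra.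
have d01 e : 0 <= d e <= 1.
  by have := a1 e; have := a0 e; have /andP[] := y01 e; case: (dcase e) => -[->]; lra.
have w01 : prob_vec w by move=> e; have := ya01 e; rewrite /w; lra.
have d1y e : 0 <= (1 - d e) * (1 - y e).
  by apply: mulr_ge0; have := y01 e; have := d01 e; lra.
have dy e : 0 <= d e * (1 - y e) by apply: mulr_ge0; have := y01 e; have := d01 e; lra.
have dy' e : 0 <= d e * y e by apply: mulr_ge0; have := y01 e; have := d01 e; lra.
have v01 : prob_vec v.
  by move=> e; have := y01 e; have := d1y e; have := dy e; rewrite /v; lra.
have wv e : w e <= v e.
  (* When [y e <= a e], the difference [v e - w e] is [(y e * (2 - a e) + y e ^+ 2) / 4]. *)
  have y2a : 0 <= y e * (2 - a e) by apply: mulr_ge0; have := y01 e; have := a1 e; lra.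
  have := sqr_ge0 (y e); rewrite expr2; have := y01 e; have := a0 e.
  by rewrite /w /v; case: (dcase e) => -[->]; move: y2a; lra.
have y4 : prob_vec (fun e => y e / 4) by move=> e; have := y01 e; lra.
have yw e : y e / 4 <= w e by have := a0 e; rewrite /w; lra.
(* Antitone gains replace [w] by [v]; the change of measure then passes from [v] to [y] at the price
   of the factor in front. *)
have key e : (1 - \sum_e d e) * expect_indep y (gain h e) <= expect_indep w (gain h e).
  apply: le_trans (expect_gain_anti e w01 v01 wv).
  have := @ler_expect_indep_scale R T y v d (gain h e) y01 d01.
  have Y0 := expect_indep_ge0 y01 (gain_ge0 e).
  move=> /(_ _ _ (gain_ge0 e)) H; apply: le_trans (H _ _).
  - by apply: ler_wpM2r => //; apply: prod_1B_ge.
  - by move=> e'; have := dy e'; have := dy' e'; rewrite /v; lra.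
  - by move=> e'; rewrite /v; lra.
(* The segment from [y / 4] to [w] has direction [a / 4], which cancels the 4 of the goal. *)
have := multilinear_diff_ge y4 w01 yw; rewrite -mulrBr -ler_pdivrMl //.
apply: le_trans; rewrite !mulr_sumr; apply: ler_sum => e _.
rewrite (_ : w e - y e / 4 = 4^-1 * a e); last by rewrite /w; field.
rewrite -mulrA ler_pM2l ?invr_gt0 // mulrCA; apply: ler_wpM2l => //.
Qed.

End SubmodularSets.

(** * The set utility as a monotone submodular set function *)

Section Utility.
Variables (R : realType) (n m : nat) (f : state_vec n m -> R).
Hypotheses (f_mono : monotone f) (f_submod : lattice_submodular f).
Implicit Types U V : {set 'I_n * 'I_m}.

Lemma vec_of_set_mono U V : U \subset V -> vle (vec_of_set U) (vec_of_set V).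
Proof.
move=> UV i; suff: (vec_of_set U i <= vec_of_set V i)%O by [].
rewrite !ffunE; apply: bigmax_le => [|s iU]; first exact: leq0n.
by apply: le_bigmax_cond; apply: (subsetP UV).
Qed.

(** Through this identity, lattice submodularity of [f] becomes submodularity of [set_utility f]. *)
Lemma vec_of_setU1 U (i : 'I_n) (s : 'I_m) :
  vec_of_set ((i, s) |: U) = vjoin (vec_of_set U) (vsingle i s).
Proof.
apply/ffunP => j; rewrite !ffunE; apply/le_anti/andP; split.
  apply: bigmax_le => [|t]; first exact: leq0n.
  rewrite !inE xpair_eqE le_max => /orP[/andP[/eqP -> /eqP ->]|jU].
    by rewrite eqxx lexx orbT.
  by apply/orP; left; apply: le_bigmax_cond.
rewrite ge_max; apply/andP; split.
  apply: bigmax_le => [|t jU]; first exact: leq0n.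
  by apply: le_bigmax_cond; rewrite !inE jU orbT.
case: eqP => [->|_]; last exact: leq0n.
by apply: le_bigmax_cond; rewrite !inE eqxx.
Qed.

Lemma set_utility_mono U V : U \subset V -> set_utility f U <= set_utility f V.
Proof. by move=> UV; apply/f_mono/vec_of_set_mono. Qed.

Lemma set_utility_submod U V e : U \subset V ->
  set_utility f (e |: V) - set_utility f V <= set_utility f (e |: U) - set_utility f U.
Proof.
case: e => i s UV; rewrite /set_utility !vec_of_setU1.
exact/f_submod/vec_of_set_mono.
Qed.

End Utility.

(** * Expectations over independent item states *)

Section States.
Variables (R : realType) (n m : nat) (p : 'I_n -> 'I_m -> R).
Hypothesis p_distr : forall i, is_distribution (p i).
Implicit Types (z : {ffun 'I_n -> 'I_m}) (g : {ffun 'I_n -> 'I_m} -> R).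

Lemma expect_stateD g g' :
  expect_state p (fun z => g z + g' z) = expect_state p g + expect_state p g'.
Proof. by rewrite -big_split; apply: eq_bigr => z _; rewrite /= mulrDr. Qed.

Lemma expect_stateZ (k : R) g : expect_state p (fun z => k * g z) = k * expect_state p g.
Proof. by rewrite /expect_state mulr_sumr; apply: eq_bigr => z _; rewrite mulrCA. Qed.

Lemma expect_state_sum (J : finType) (g : J -> {ffun 'I_n -> 'I_m} -> R) :
  expect_state p (fun z => \sum_j g j z) = \sum_j expect_state p (g j).
Proof. by rewrite /expect_state exchange_big; apply: eq_bigr => z _; rewrite /= mulr_sumr. Qed.

Lemma eq_expect_state g g' : g =1 g' -> expect_state p g = expect_state p g'.
Proof. by move=> gg'; apply: eq_bigr => z _; rewrite gg'. Qed.

Lemma le_expect_state g g' : (forall z, g z <= g' z) ->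
  expect_state p g <= expect_state p g'.
Proof.
move=> gg'; apply: ler_sum => z _; apply: ler_wpM2l => //.
by apply: prodr_ge0 => i _; case: (p_distr i).
Qed.

Lemma expect_state_cst (k : R) : expect_state p (fun=> k) = k.
Proof.
rewrite /expect_state -mulr_suml -(bigA_distr_bigA (fun i s => p i s)).
by rewrite big1 ?mul1r // => i _; case: (p_distr i).
Qed.

Definition set_state z i s : {ffun 'I_n -> 'I_m} := [ffun j => if j == i then s else z j].

(* Exchanging the value of [z] at [i] with an independent copy [s] preserves
   the product law of the pair [(s, z)]. *)
Lemma expect_state_resample (i : 'I_n) (g : 'I_m -> {ffun 'I_n -> 'I_m} -> R) :
  (forall s z t, g s (set_state z i t) = g s z) ->
  expect_state p (fun z => g (z i) z) = \sum_s p i s * expect_state p (g s).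
Proof.
move=> gE; rewrite /expect_state.
under [RHS]eq_bigr do rewrite mulr_sumr.
rewrite pair_big /=.
pose swap (q : 'I_m * {ffun 'I_n -> 'I_m}) := (q.2 i, set_state q.2 i q.1).
have swapK : involutive swap.
  move=> [s z]; rewrite /swap /= ffunE eqxx; congr pair.
  by apply/ffunP => j; rewrite !ffunE; case: eqP => [->|].
rewrite (reindex_inj (inv_inj swapK)) /=.
rewrite [RHS](eq_bigr (fun q : 'I_m * {ffun 'I_n -> 'I_m} =>
    p i q.1 * (\prod_j p j (q.2 j) * g (q.2 i) q.2))); last first.
  move=> q _; rewrite gE (bigD1 i) //= ffunE eqxx [in RHS](bigD1 i) //=.
  rewrite (eq_bigr (fun j => p j (q.2 j))); first by ring.
  by move=> j ji; rewrite ffunE (negPf ji).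
rewrite -(pair_big xpredT xpredT (fun s (z : {ffun 'I_n -> 'I_m}) =>
  p i s * (\prod_j p j (z j) * g (z i) z))) /=.
under [RHS]eq_bigr do rewrite -mulr_sumr.
by rewrite -mulr_suml; case: (p_distr i) => _ ->; rewrite mul1r.
Qed.

Lemma expect_state_eq i s : expect_state p (fun z => (z i == s)%:R) = p i s.
Proof.
rewrite (@expect_state_resample i (fun t _ => (t == s)%:R)) //.
rewrite (bigD1 s) //= big1 => [|t /negPf ->]; last by rewrite expect_state_cst mulr0.
by rewrite expect_state_cst eqxx mulr1 addr0.
Qed.

Lemma sum_distribution_pair : \sum_e p e.1 e.2 = n%:R.
Proof.
rewrite -(pair_big xpredT xpredT (fun i s => p i s)) /=.
rewrite (eq_bigr (fun=> 1)); last by move=> i _; case: (p_distr i).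
by rewrite sumr_const card_ord.
Qed.

Lemma distribution_le1 i s : p i s <= 1.
Proof.
have [p0 <-] := p_distr i; rewrite (bigD1 s) //= lerDl.
by apply: sumr_ge0 => t _.
Qed.

End States.

(** * The LP as an upper bound on adaptive policies *)

Section Policy.
Variables (R : realType) (n m : nat) (f : state_vec n m -> R) (p c : 'I_n -> 'I_m -> R).
Variable B : R.
Hypotheses (f_mono : monotone f) (f_submod : lattice_submodular f).
Hypothesis p_distr : forall i, is_distribution (p i).
Variable pi : policy n m.

Definition pick_prob : {ffun 'I_n * 'I_m -> R} :=
  [ffun e => expect_state p (fun z => (e \in picked pi z)%:R)].

Lemma picked_state z e : e \in picked pi z -> z e.1 = e.2.
Proof.
elim: pi => [|i pick next IH] /=; first by rewrite inE.
rewrite inE; case: (pick (z i)) => /orP[|/IH //]; rewrite inE => // /eqP -> //.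
Qed.

(** A pair [(i, s)] is picked only if [z i = s], hence with probability at most [p i s]; averaging
    the budget constraint over [z] gives the cost bound. *)
Lemma pick_prob_feasible : feasible c B pi -> lp_feasible p c B pick_prob.
Proof.
case=> _ cost; split=> [e|].
  rewrite ffunE; apply/andP; split.
    rewrite -[X in X <= _](expect_state_cst p_distr 0).
    by apply: le_expect_state => // z; rewrite ler0n.
  rewrite -[X in _ <= X](expect_state_eq p_distr).
  apply: le_expect_state => // z; case: (boolP (e \in picked pi z)) => [/picked_state ->|_].
    by rewrite eqxx.
  by rewrite ler0n.
rewrite -[X in _ <= X](expect_state_cst p_distr B).
apply: le_trans (le_expect_state p_distr cost).
under eq_bigr do rewrite ffunE mulrC -expect_stateZ.
rewrite -expect_state_sum; apply: le_expect_state => // z.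
rewrite /set_cost [X in _ <= X]big_mkcond; apply: ler_sum => e _.
by case: ifP; rewrite ?mulr1 ?mulr0.
Qed.

Lemma marginalE y e : marginal f y e =
  expect_indep y (fun U => set_utility f (e |: U) - set_utility f U).
Proof.
rewrite expect_indepB; congr (_ - _).
by apply: eq_expect_indep => // U; rewrite setUC.
Qed.

(** For fixed [z] and [U], the utility of the picks is at most that of their union with [U], hence
    at most that of [U] plus the separate gains of the picks. As [U] is drawn independently of [z],
    averaging separates marginals from pick probabilities. *)
Lemma policy_utility_le (y : {ffun 'I_n * 'I_m -> R}) : prob_vec y ->
  policy_utility f p pi <=
  multilinear_ext f y + \sum_e marginal f y e * pick_prob e.
Proof.
move=> y01; rewrite /policy_utility.
have -> : multilinear_ext f y + \sum_e marginal f y e * pick_prob e =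
    expect_state p (fun z => multilinear_ext f y +
      \sum_e marginal f y e * (e \in picked pi z)%:R).
  rewrite expect_stateD expect_state_cst // expect_state_sum; congr (_ + _).
  by apply: eq_bigr => e _; rewrite ffunE expect_stateZ.
apply: le_expect_state => // z.
have -> : multilinear_ext f y + \sum_e marginal f y e * (e \in picked pi z)%:R =
    expect_indep y (fun U => set_utility f U + \sum_e (e \in picked pi z)%:R *
      (set_utility f (e |: U) - set_utility f U)).
  rewrite expect_indepD expect_indep_sum; congr (_ + _).
  by apply: eq_bigr => e _; rewrite expect_indepZ marginalE mulrC.
rewrite -[X in X <= _](expect_indep_cst y); apply: le_expect_indep => // U.
have := submod_setU_sum (set_utility_submod f_submod) U (picked pi z).
rewrite [X in _ + X]big_mkcond /= => le_sum.
apply: le_trans (set_utility_mono f_mono (subsetUr U _)) (le_trans le_sum _).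
rewrite lerD2l; apply: ler_sum => e _.
by case: ifP; rewrite ?mul1r ?mul0r.
Qed.

End Policy.

(** * Analysis of the continuous greedy iterates *)

Section Greedy.
Variables (R : realType) (n m : nat) (f : state_vec n m -> R) (p c : 'I_n -> 'I_m -> R).
Variables (B : R) (Y : nat -> {ffun 'I_n * 'I_m -> R}).
Hypotheses (n_gt0 : (0 < n)%N) (m_gt0 : (0 < m)%N).
Hypotheses (f_ge0 : forall u, 0 <= f u) (f_mono : monotone f).
Hypothesis f_submod : lattice_submodular f.
Hypothesis p_distr : forall i, is_distribution (p i).

Let N := ((n * m) ^ 2)%N.
Let delta : R := 1 / N%:R.

Hypothesis Y0 : forall e, Y 0%N e = 0.
Hypothesis YS : forall k, (k < N)%N ->
  exists2 x, lp_optimal p c B (marginal f (Y k)) x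
           & forall e, Y k.+1 e = Y k e + delta * x e.

Let N_gt0 : (0 < N)%N. Proof. by rewrite expn_gt0 muln_gt0 n_gt0 m_gt0. Qed.

Let delta_gt0 : 0 < delta. Proof. by rewrite divr_gt0 // ltr0n. Qed.

Let N_delta : N%:R * delta = 1.
Proof. by rewrite mulrC divfK // pnatr_eq0 -lt0n. Qed.

(** Since the [p e.1 e.2] sum to [n], this says that one greedy step adds total mass at most 1. *)
Let delta_n : delta * n%:R <= 1.
Proof.
rewrite mulrC -[leRHS]N_delta ler_pM2r // ler_nat /N expnS expn1.
by rewrite -mulnA leq_pmulr // muln_gt0 m_gt0 muln_gt0 n_gt0.
Qed.

Let delta_le1 : delta <= 1.
Proof.
apply: le_trans delta_n; rewrite ler_peMr ?(ltW delta_gt0) //.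
by rewrite (ler_nat _ 1).
Qed.

Let p_ge0 e : 0 <= p e.1 e.2. Proof. by case: (p_distr e.1). Qed.

(** [Y k] is [delta] times a sum of [k] LP-feasible points. *)
Lemma greedy_iterate_bounds k : (k <= N)%N ->
  (forall e, 0 <= Y k e <= k%:R * delta * p e.1 e.2) /\
  \sum_e Y k e * c e.1 e.2 <= k%:R * delta * B.
Proof.
elim: k => [_|k IH kN].
  rewrite !mul0r; split=> [e|]; first by rewrite Y0 !mul0r lexx.
  by rewrite big1 // => e _; rewrite Y0 mul0r.
have [IHp IHc] := IH (ltnW kN).
have [x [[xp xc] _] YE] := YS kN; split=> [e|].
  have := IHp e; have /andP[x0 x1] := xp e; rewrite YE -natr1 !mulrDl mul1r.
  have := mulr_ge0 (ltW delta_gt0) x0; have := ler_wpM2l (ltW delta_gt0) x1; lra.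
have -> : \sum_e Y k.+1 e * c e.1 e.2 =
    \sum_e Y k e * c e.1 e.2 + delta * \sum_e x e * c e.1 e.2.
  by rewrite mulr_sumr -big_split; apply: eq_bigr => e _; rewrite /= YE; ring.
have := ler_wpM2l (ltW delta_gt0) xc; rewrite -natr1 !mulrDl mul1r; lra.
Qed.

Lemma greedy_output_feasible : lp_feasible p c B (Y N).
Proof.
have [Yp Yc] := greedy_iterate_bounds (leqnn N).
by split=> [e|]; [have := Yp e | move: Yc]; rewrite N_delta mul1r.
Qed.

Lemma greedy_iterate_prob k : (k <= N)%N -> prob_vec (Y k).
Proof.
move=> kN e; have [/(_ e)/andP[-> Yp] _] := greedy_iterate_bounds kN.
apply: le_trans Yp _; rewrite -[leRHS]mulr1; apply: ler_pM => //.
- by rewrite mulr_ge0 ?(ltW delta_gt0).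
- by rewrite -[leRHS]N_delta ler_pM2r // ler_nat.
- exact: distribution_le1.
Qed.

(** A benchmark, later the utility of the optimal policy; the greedy analysis knows it only through
    nonnegativity and the LP bound [O_le]. *)
Variable O : R.
Hypothesis O_ge0 : 0 <= O.
Hypothesis O_le : forall y : {ffun 'I_n * 'I_m -> R}, prob_vec y ->
  exists2 x, lp_feasible p c B x
           & O <= multilinear_ext f y + \sum_e marginal f y e * x e.

Let quarter k := 4 * expect_indep (fun e => Y k e / 4) (set_utility f).
(** The cap [delta * p e.1 e.2] is the most that one step adds to [e]; a pair whose weight has
    reached it causes no further loss. *)
Let loss k := \sum_e Num.min (Y k e) (delta * p e.1 e.2) / 4.

(* The second-order loss of a step only comes from pairs [e] with
   [delta * x e > Y k e], so over the whole run it is paid for by [loss]. *)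
Lemma greedy_step k : (k < N)%N -> exists2 l,
  0 <= l <= 1 & l <= loss k.+1 - loss k /\
  O - quarter k.+1 <= (1 - delta * (1 - l)) * (O - quarter k).
Proof.
move=> kN; have [x [[xp xc] xopt] YE] := YS kN.
have Y01 := greedy_iterate_prob (ltnW kN); have YS01 := greedy_iterate_prob kN.
have U0 U : 0 <= set_utility f U by apply: f_ge0.
have Umono := set_utility_mono f_mono; have Usub := set_utility_submod f_submod.
pose a e := delta * x e.
have a0 e : 0 <= a e by apply: mulr_ge0; [exact: ltW | case/andP: (xp e)].
have ap e : a e <= delta * p e.1 e.2.
  by apply: ler_wpM2l; [exact: ltW | case/andP: (xp e)].
pose l := \sum_e Num.max 0 (a e - Y k e) / 4.
have l01 : 0 <= l <= 1.
  apply/andP; split; first by apply: sumr_ge0 => e _; rewrite divr_ge0 // le_max lexx.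
  apply: le_trans (_ : \sum_e delta * p e.1 e.2 <= 1).
    apply: ler_sum => e _; have := Y01 e; have := a0 e; have := ap e.
    by case: (leP 0 (a e - Y k e)); lra.
  by rewrite -mulr_sumr sum_distribution_pair.
exists l => //; split.
  rewrite /l /loss -sumrB; apply: ler_sum => e _; rewrite YE -/(a e).
  have := Y01 e; have := a0 e; have := ap e.
  case: (leP 0 (a e - Y k e)); case: (leP (Y k e) (delta * p e.1 e.2));
    case: (leP (Y k e + a e) (delta * p e.1 e.2)); lra.
have YSa : prob_vec (fun e => Y k e + a e) by move=> e; rewrite -YE.
have := quarter_step Umono Usub Y01 a0 YSa.
have -> : 4 * expect_indep (fun e => (Y k e + a e) / 4) (set_utility f) = quarter k.+1.
  by congr (_ * _); apply: eq_expect_indep => // e; rewrite YE.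
rewrite -/(quarter k) -/l.
have [x' x'P Ox'] := O_le Y01; have x'x := xopt _ x'P.
have Yq := multilinear_quarter U0 Usub Y01.
(* The LP coefficient counts 0 when [e \in U], whereas [gain] compares with [U :\ e]; so it is at
   most the gradient. *)
have gain_ge : delta * \sum_e marginal f (Y k) e * x e <=
    \sum_e a e * expect_indep (Y k) (gain (set_utility f) e).
  rewrite mulr_sumr; apply: ler_sum => e _; rewrite mulrCA mulrC -/(a e).
  apply: ler_wpM2l => //; rewrite marginalE; apply: le_expect_indep => // U.
  by rewrite lerD2l lerN2; apply/Umono/subD1set.
set W := \sum_e marginal f (Y k) e * x e in x'x gain_ge.
set g := \sum_e a e * _ in gain_ge *.
have l1 : 0 <= 1 - l by case/andP: l01 => _; rewrite subr_ge0.
have WO : delta * (O - quarter k) <= delta * W.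
  apply: ler_wpM2l; first exact: ltW.
  by move: Ox' x'x Yq; rewrite /quarter /multilinear_ext; lra.
have := ler_wpM2l l1 (le_trans WO gain_ge); lra.
Qed.

Lemma greedy_quarter_ge : (1 - 1 / expR 1) * O <=
  4 * expect_indep (fun e => Y N e / 4) (set_utility f).
Proof.
(* The exponent comes from expanding [u + u ^+ 2 / 2] at [u = delta * (1 - l)], dropping the term in
   [l ^+ 2], and bounding [l] by the increment of [loss]. *)
have main k : (k <= N)%N -> O - quarter k <=
    O * expR ((delta + delta ^+ 2) * loss k - k%:R * (delta + delta ^+ 2 / 2)).
  elim: k => [_|k IH kN].
    have -> : loss 0 = 0.
      rewrite /loss big1 // => e _; rewrite Y0 min_l ?mul0r //.
      by rewrite mulr_ge0 // ltW.
    rewrite mulr0 mul0r subr0 expR0 mulr1 gerBl mulr_ge0 //.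
    by apply: expect_indep_ge0 => [e|U]; [rewrite Y0 mul0r lexx ler01 | apply: f_ge0].
  have [l /andP[l0 l1] [lloss stepk]] := greedy_step kN.
  set u := delta * (1 - l) in stepk.
  have u0 : 0 <= u by rewrite mulr_ge0 ?subr_ge0 // ltW.
  have u1 : 0 <= 1 - u.
    by rewrite subr_ge0 mulr_ile1 ?subr_ge0 ?gerBl // ltW.
  apply: le_trans stepk _; apply: le_trans (ler_wpM2l u1 (IH (ltnW kN))) _.
  rewrite mulrCA; apply: ler_wpM2l => //.
  apply: le_trans (ler_wpM2r (expR_ge0 _) (oneB_le_expR u0)) _.
  rewrite -expRD ler_expR -(natr1 k).
  have : (delta + delta ^+ 2) * l <= (delta + delta ^+ 2) * (loss k.+1 - loss k).
    by apply: ler_wpM2l => //; rewrite addr_ge0 ?sqr_ge0 // ltW.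
  have := sqr_ge0 (delta * l); rewrite /u; lra.
have lossN : loss N <= 1 / 4.
  apply: le_trans (_ : \sum_e (delta * p e.1 e.2) / 4 <= _).
    by apply: ler_sum => e _; rewrite ler_pM2r ?invr_gt0 // ge_min lexx orbT.
  by rewrite -mulr_suml -mulr_sumr sum_distribution_pair // ler_pM2r ?invr_gt0.
have := main N (leqnn N); rewrite -/(quarter N).
(* At [k = N] the subtracted part is [1 + delta / 2], and the loss gives back at most
   [(delta + delta ^+ 2) / 4 <= delta / 2]. *)
have : expR ((delta + delta ^+ 2) * loss N - N%:R * (delta + delta ^+ 2 / 2)) <=
    1 / expR 1.
  rewrite div1r -expRN ler_expR.
  have -> : N%:R * (delta + delta ^+ 2 / 2) = (N%:R * delta) * (1 + delta / 2) by ring.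
  rewrite N_delta mul1r.
  have d2 : 0 <= delta + delta ^+ 2 by rewrite addr_ge0 ?sqr_ge0 // ltW.
  have := ler_wpM2l d2 lossN.
  have := ler_wpM2l (ltW delta_gt0) delta_le1; rewrite -expr2; lra.
move/(ler_wpM2l O_ge0); rewrite mulrBl mul1r mulrC; lra.
Qed.

End Greedy.

(** * Rounding by a threshold policy *)

Section Rounding.
Variables (R : realType) (n m : nat) (f : state_vec n m -> R) (p c : 'I_n -> 'I_m -> R).
Variables (B : R) (y : {ffun 'I_n * 'I_m -> R}) (keep : 'I_n * 'I_m -> bool).
Hypotheses (f_ge0 : forall u, 0 <= f u) (f_mono : monotone f).
Hypothesis f_submod : lattice_submodular f.
Hypothesis p_distr : forall i, is_distribution (p i).
Hypotheses (c_ge0 : forall i s, 0 <= c i s) (B_gt0 : 0 < B).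
Hypothesis y_feas : lp_feasible p c B y.
(** The only trait of the threshold on which the rounding relies; it is established separately for
    the small and the large policy. *)
Hypothesis keep_fits : forall (G : {set 'I_n * 'I_m}) i s,
  (forall e, e \in G -> keep e) -> set_cost c G <= B / 2 ->
  keep (i, s) -> 0 < p i s -> c i s <= B - set_cost c G.

Implicit Types (G U C : {set 'I_n * 'I_m}) (l : seq 'I_n) (i : 'I_n) (s : 'I_m).
Implicit Types (e : 'I_n * 'I_m) (z : {ffun 'I_n -> 'I_m}).

Let h := set_utility f.
Let q e := y e / (4 * p e.1 e.2).
(** The probability that [e] is observed and its coin says add. *)
Let r e := y e / 4.

Let h_ge0 U : 0 <= h U. Proof. exact: f_ge0. Qed.
Let h_mono (U V : {set 'I_n * 'I_m}) : U \subset V -> h U <= h V.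
Proof. exact: set_utility_mono. Qed.
Let h_submod (U V : {set 'I_n * 'I_m}) e : U \subset V -> h (e |: V) - h V <= h (e |: U) - h U.
Proof. exact: set_utility_submod. Qed.

Let p_ge0 e : 0 <= p e.1 e.2. Proof. by case: (p_distr e.1). Qed.
Let y_ge0 e : 0 <= y e. Proof. by case: y_feas => /(_ e)/andP[]. Qed.
Let y_le e : y e <= p e.1 e.2. Proof. by case: y_feas => /(_ e)/andP[]. Qed.

Let r_ge0 e : 0 <= r e. Proof. by rewrite divr_ge0. Qed.

Let r_prob : prob_vec r.
Proof.
move=> e; rewrite r_ge0 /r /=.
have := y_le e; have := distribution_le1 p_distr e.1 e.2; lra.
Qed.

Let pq e : p e.1 e.2 * q e = r e.
Proof.
(* If [p e.1 e.2 = 0], the LP bound forces [y e = 0], so both sides vanish despite the division by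
   0. *)
rewrite /q /r; have [p0|p0] := eqVneq (p e.1 e.2) 0; last by field.
have -> : y e = 0 by apply/le_anti; rewrite y_ge0 -p0 y_le.
by rewrite !mul0r mulr0.
Qed.

Let q_prob : prob_vec q.
Proof.
move=> e; rewrite /q; have [p0|p0] := eqVneq (p e.1 e.2) 0.
  by rewrite p0 mulr0 invr0 mulr0 lexx ler01.
have pgt0 : 0 < p e.1 e.2 by rewrite lt0r p0 p_ge0.
rewrite divr_ge0 ?mulr_ge0 //= ler_pdivrMr ?mulr_gt0 // mul1r.
have := y_le e; lra.
Qed.

(** [threshold_run] from an arbitrary current set and list of remaining items, as induction on the
    items requires. *)
Let run z C G l := foldl (fun G i =>
  if [&& keep (i, z i), c i (z i) <= B - set_cost c G & (i, z i) \in C]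
  then (i, z i) |: G else G) G l.

Let eq_run z z' C C' G l : {in l, z =1 z'} ->
  (forall i, i \in l -> ((i, z i) \in C) = ((i, z i) \in C')) ->
  run z C G l = run z' C' G l.
Proof.
elim: l G => [|i l IH] G //= zz' CC'; rewrite -zz' ?CC' ?mem_head //.
by apply: IH => [j jl|j jl]; [apply: zz' | apply: CC']; rewrite inE jl orbT.
Qed.

Let sub_run z C G l : G \subset run z C G l.
Proof.
elim: l G => [|i l IH] G //=; apply: subset_trans (IH _).
by case: ifP => // _; apply: subsetUr.
Qed.

Let value l G :=
  expect_state p (fun z => expect_indep q (fun C => h (run z C G l))).

Let try_add G e := if keep e && (c e.1 e.2 <= B - set_cost c G) then e |: G else G.

(** Once the coin of [(i, z i)] is fixed, the rest of the run reads neither the state nor the coins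
    of [i], so the state of [i] can be resampled. *)
Let value_cons i l G : i \notin l ->
  value (i :: l) G = \sum_s p i s *
    (q (i, s) * value l (try_add G (i, s)) + (1 - q (i, s)) * value l G).
Proof.
move=> il; have ne j : j \in l -> j != i by move=> jl; apply: contraNneq il => <-.
pose g s z := q (i, s) * expect_indep q (fun C => h (run z C (try_add G (i, s)) l)) +
  (1 - q (i, s)) * expect_indep q (fun C => h (run z C G l)).
have -> : value (i :: l) G = expect_state p (fun z => g (z i) z).
  apply: eq_expect_state => z; rewrite (expect_indep_split _ _ (i, z i)) /=.
  congr (_ * _ + _ * _); apply: eq_expect_indep => // C; congr h.
    rewrite setU11 andbT; apply: eq_run => // j /ne ji.
    by rewrite !inE xpair_eqE (negPf ji).
  rewrite setD11 !andbF; apply: eq_run => // j /ne ji.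
  by rewrite !inE xpair_eqE (negPf ji).
rewrite (@expect_state_resample R n m p p_distr i g); last first.
  move=> s z t; congr (_ * _ + _ * _); apply: eq_expect_indep => // C; congr h;
    by apply: eq_run => j /ne ji; rewrite ?ffunE ?(negPf ji).
apply: eq_bigr => s _; congr (_ * _).
by rewrite expect_stateD !expect_stateZ.
Qed.

Let value_ge l G : h G <= value l G.
Proof.
rewrite -[X in X <= _](expect_state_cst p_distr); apply: le_expect_state => // z.
rewrite -[X in X <= _](expect_indep_cst q); apply: le_expect_indep => // C.
exact: h_mono.
Qed.

Let kept l := [set e | (e.1 \in l) && keep e].
(** A relaxation: the budget is ignored and all pairs are independent, so several states of one item
    may be candidates together. *)
Let free_value l G := expect_indep r (fun U => h (G :|: (U :&: kept l))).
Let total := expect_indep r (fun U => h (U :&: [set e | keep e])).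
(** The expected cost of the candidates that the items of [l] produce. *)
Let load l := \sum_(i <- l) \sum_(s | keep (i, s)) r (i, s) * c i s.

Let load_ge0 l : 0 <= load l.
Proof. by apply: sumr_ge0 => i _; apply: sumr_ge0 => s _; apply: mulr_ge0. Qed.

Let total_ge0 : 0 <= total. Proof. exact: expect_indep_ge0. Qed.

Let free_value_le l G : free_value l G <= h G + total.
Proof.
rewrite -[X in X + _](expect_indep_cst r) -expect_indepD; apply: le_expect_indep => // U.
apply: le_trans (submod_subadd h_ge0 h_submod _ _) _; rewrite lerD2l.
by apply/h_mono/setIS/subsetP => e; rewrite !inE => /andP[].
Qed.

Let sum_fst i (P : pred ('I_n * 'I_m)) (F : 'I_n * 'I_m -> R) :
  \sum_(e | (e.1 == i) && P e) F e = \sum_(s | P (i, s)) F (i, s).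
Proof.
transitivity (\sum_(j | j == i) \sum_(s | P (j, s)) F (j, s)).
  by rewrite pair_big_dep /=; apply: eq_big => -[].
by rewrite big_pred1_eq.
Qed.

(** Submodularity bounds the joint contribution of the states of [i] by the sum of their separate
    ones. This sum matches the recursion [value_cons], where the states of [i] exclude each
    other. *)
Let free_value_cons i l G : i \notin l ->
  free_value (i :: l) G <= free_value l G +
    \sum_(s | keep (i, s)) r (i, s) * (free_value l ((i, s) |: G) - free_value l G).
Proof.
move=> il; rewrite -(sum_fst i keep (fun e =>
  r e * (free_value l (e |: G) - free_value l G))).
rewrite big_mkcond /=.
have -> : free_value l G + \sum_e (if (e.1 == i) && keep e
    then r e * (free_value l (e |: G) - free_value l G) else 0) =
  expect_indep r (fun U => h (G :|: (U :&: kept l)) +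
    \sum_e ((e.1 == i) && keep e)%:R * ((e \in U)%:R *
      (h (e |: (G :|: (U :&: kept l))) - h (G :|: (U :&: kept l))))).
  rewrite expect_indepD expect_indep_sum; congr (_ + _); apply: eq_bigr => e _.
  rewrite expect_indepZ; case: ifP => [/andP[/eqP ei _]|_]; last by rewrite mul0r.
  have eU U : (e |: U) :&: kept l = (U :\ e) :&: kept l.
    apply/setP => e'; rewrite !inE; case: eqP => //= ->.
    by rewrite ei (negPf il).
  rewrite mul1r expect_indep_mem_mul => [|U]; last by rewrite eU.
  rewrite expect_indepB; congr (_ * (_ - _)).
  by apply: eq_expect_indep => // U; rewrite setUA.
apply: le_expect_indep => // U.
have -> : G :|: (U :&: kept (i :: l)) =
    (G :|: (U :&: kept l)) :|: [set e in U | (e.1 == i) && keep e].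
  apply/setP => e; rewrite !inE.
  by case: (e \in G); case: (e \in U); case: (e.1 == i); case: (keep e); case: (e.1 \in l).
apply: le_trans (submod_setU_sum h_submod _ _) _; rewrite lerD2l big_mkcond /=.
apply: ler_sum => e _; rewrite inE.
by case: (e \in U); case: (e.1 == i); case: (keep e); rewrite ?mul1r ?mul0r ?mulr0.
Qed.

Let set_costU1 e G : set_cost c (e |: G) <= set_cost c G + c e.1 e.2.
Proof.
have [eG|eG] := boolP (e \in G).
  by rewrite (setUidPr _) ?sub1set // lerDl.
by rewrite /set_cost big_setU1 //= addrC.
Qed.

Let set_cost_ge0 G : 0 <= set_cost c G. Proof. by apply: sumr_ge0. Qed.

(* As long as the picks cost at most [B / 2] every kept candidate is picked;
   once they cost more, the penalty exceeds all that is left to gain.  So this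
   Markov-type bound on the penalty passes through the recursion on items. *)
Let value_lower l G : uniq l -> (forall e, e \in G -> keep e) ->
  free_value l G - total / (B / 2) * (set_cost c G + load l) <= value l G.
Proof.
(* At price [k] per unit of cost, spending [B / 2] is charged exactly [total]. *)
set k := total / (B / 2).
have k0 : 0 <= k by rewrite !divr_ge0 // ltW.
have kB : k * (B / 2) = total by rewrite divfK // lt0r_neq0 // divr_gt0.
elim: l G => [|i l IH] G.
  move=> _ _; rewrite /free_value /value /run /=.
  rewrite (eq_expect_indep (y := r) (h := fun=> h G)) => // [|U]; last first.
    by congr h; apply/setP => e; rewrite !inE /= andbF orbF.
  under eq_expect_state do rewrite expect_indep_cst.
  rewrite expect_state_cst // expect_indep_cst gerBl mulr_ge0 //.
  by rewrite addr_ge0.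
rewrite cons_uniq => /andP[il ul] Gk.
have [costG|costG] := leP (set_cost c G) (B / 2); last first.
  apply: le_trans (value_ge _ _); rewrite lerBlDr.
  apply: le_trans (free_value_le _ _) _; rewrite lerD2l -kB.
  apply: ler_wpM2l => //; have := load_ge0 (i :: l); lra.
rewrite value_cons //.
(* [A] is the inductive bound with [i] skipped; the sum below is what the candidates of [i] add,
   each charged its own cost. *)
set A := free_value l G - k * (set_cost c G + load l).
apply: le_trans (_ : A + \sum_(s | keep (i, s)) r (i, s) *
    (free_value l ((i, s) |: G) - free_value l G - k * c i s) <= _).
  have := free_value_cons G il; rewrite /A /load big_cons -/(load l).
  have -> : \sum_(s | keep (i, s)) r (i, s) *
        (free_value l ((i, s) |: G) - free_value l G - k * c i s) =
      \sum_(s | keep (i, s)) r (i, s) * (free_value l ((i, s) |: G) - free_value l G) -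
      k * \sum_(s | keep (i, s)) r (i, s) * c i s.
    by rewrite mulr_sumr -sumrB; apply: eq_bigr => s _; ring.
  lra.
have -> : A = \sum_s p i s * A by rewrite -mulr_suml; case: (p_distr i) => _ ->; rewrite mul1r.
rewrite [X in _ + X]big_mkcond -big_split /=; apply: ler_sum => s _.
have AV : A <= value l G by apply: IH.
have q0 : 0 <= q (i, s) by case/andP: (q_prob (i, s)).
have q1 : 0 <= 1 - q (i, s) by case/andP: (q_prob (i, s)); rewrite subr_ge0.
have ps0 : 0 <= p i s by apply: (p_ge0 (i, s)).
have pqs : p i s * q (i, s) = r (i, s) by apply: (pq (i, s)).
case: ifP => ks; last first.
  by rewrite addr0 /try_add ks -mulrDl addrC subrK mul1r; apply: ler_wpM2l.
(* [keep_fits] covers only states of positive probability; the others have [r (i, s) = 0]. *)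
have [p0|p0] := eqVneq (p i s) 0; first by rewrite -pqs p0 !mul0r addr0.
have pgt0 : 0 < p i s by rewrite lt0r p0.
rewrite /try_add ks keep_fits //=.
have V' : free_value l ((i, s) |: G) - k * (set_cost c G + c i s + load l) <=
    value l ((i, s) |: G).
  apply: le_trans (IH _ ul _); last by move=> e; rewrite !inE => /orP[/eqP ->|/Gk].
  by rewrite lerD2l lerN2; apply: ler_wpM2l => //; rewrite lerD2r set_costU1.
rewrite -pqs -mulrA -mulrDr; apply: ler_wpM2l => //.
have := ler_wpM2l q0 V'; have := ler_wpM2l q1 AV; rewrite /A; lra.
Qed.

(** The expected load of all items is at most [B / 4], so the penalty takes away at most half of
    [total]. *)
Lemma threshold_utility_ge :
  1 / 2 * expect_indep (fun e => y e / 4) (fun U => set_utility f (U :&: [set e | keep e]))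
  <= threshold_utility f p c B y keep.
Proof.
have no_pick e : e \in (set0 : {set 'I_n * 'I_m}) -> keep e by rewrite inE.
have := value_lower (enum_uniq 'I_n) no_pick.
have -> : value (enum 'I_n) set0 = threshold_utility f p c B y keep by [].
have -> : free_value (enum 'I_n) set0 = total.
  apply: eq_expect_indep => // U; congr h; apply/setP => e.
  by rewrite !inE mem_enum.
apply: le_trans; rewrite -/total /set_cost big_set0 add0r.
have load_le : load (enum 'I_n) <= B / 4.
  case: y_feas => _ yc; rewrite /load big_enum /= pair_big_dep /=.
  apply: le_trans (_ : \sum_e y e * c e.1 e.2 / 4 <= _); last first.
    by rewrite -mulr_suml ler_pM2r ?invr_gt0.
  rewrite big_mkcond; apply: ler_sum => -[i s] _ /=.
  case: ifP => _; first by rewrite /r mulrAC.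
  by rewrite divr_ge0 // mulr_ge0.
have k0 : 0 <= total / (B / 2) by rewrite !divr_ge0 // ltW.
have := ler_wpM2l k0 load_le.
have -> : total / (B / 2) * (B / 4) = total / 2 by field; rewrite lt0r_neq0.
by rewrite /total; lra.
Qed.

End Rounding.

(** * Combining the greedy bound with the two roundings *)

Theorem theorem1 (R : realType) (n m : nat) (hn : (0 < n)%N) (hm : (0 < m)%N)
    (f : state_vec n m -> R)
    (f_ge0 : forall u, 0 <= f u)
    (f_mono : monotone f)
    (f_submod : lattice_submodular f)
    (p : 'I_n -> 'I_m -> R)
    (p_distr : forall i, is_distribution (p i))
    (c : 'I_n -> 'I_m -> R)
    (c_ge0 : forall i s, 0 <= c i s)
    (c_mono : forall i (s s' : 'I_m), (s' <= s)%N -> c i s' <= c i s)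
    (B : R) (B_gt0 : 0 < B)
    (* every state that can occur fits in the budget on its own *)
    (c_le_B : forall i s, 0 < p i s -> c i s <= B)
    (pistar : policy n m) (pistar_opt : optimal_policy f p c B pistar)
    (y : {ffun 'I_n * 'I_m -> R})
    (y_greedy : continuous_greedy_output f p c B y) :
  (1 - 1 / expR 1) / 16 * policy_utility f p pistar <=
    1 / 2 * (small_utility f p c B y + large_utility f p c B y).
Proof.
have [Y [Y0 YS yE]] := y_greedy; have [pistar_feas _] := pistar_opt.
have y_feas : lp_feasible p c B y.
  by rewrite yE; apply: greedy_output_feasible Y0 YS.
have opt_ge0 : 0 <= policy_utility f p pistar.
  rewrite -[leLHS](expect_state_cst p_distr 0); apply: le_expect_state => // z.
  exact: f_ge0.
have greedy : (1 - 1 / expR 1) * policy_utility f p pistar <=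
    4 * expect_indep (fun e => y e / 4) (set_utility f).
  rewrite yE; apply: (greedy_quarter_ge (p := p) (c := c) (B := B)) => // x x01.
  exists (pick_prob p pistar); first exact: pick_prob_feasible.
  exact: policy_utility_le.
have small : 1 / 2 * expect_indep (fun e => y e / 4)
    (fun U => set_utility f (U :&: [set e | c e.1 e.2 <= B / 2])) <= small_utility f p c B y.
  by apply: threshold_utility_ge => // G i s _ costG /= ? _; lra.
have large : 1 / 2 * expect_indep (fun e => y e / 4)
    (fun U => set_utility f (U :&: [set e | B / 2 < c e.1 e.2])) <= large_utility f p c B y.
  apply: threshold_utility_ge => // G i s Glarge costG _ /c_le_B cB.
  (* One large pick already costs more than [B / 2], so [G] must be empty, and a possible state fits
     in [B] alone. *)
  have [->|[e eG]] := set_0Vmem G; first by rewrite /set_cost big_set0 subr0.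
  have := Glarge e eG; rewrite ltNge => /negP[]; apply: le_trans costG.
  by rewrite /set_cost (big_setD1 e) //= lerDl; apply: sumr_ge0.
have split : expect_indep (fun e => y e / 4) (set_utility f) <=
    expect_indep (fun e => y e / 4)
      (fun U => set_utility f (U :&: [set e | c e.1 e.2 <= B / 2])) +
    expect_indep (fun e => y e / 4)
      (fun U => set_utility f (U :&: [set e | B / 2 < c e.1 e.2])).
  rewrite -expect_indepD; apply: le_expect_indep => [e|U].
    have [/(_ e) yp _] := y_feas; have := distribution_le1 p_distr e.1 e.2.
    by move: yp; lra.
  have {1}<- : (U :&: [set e | c e.1 e.2 <= B / 2]) :|:
      (U :&: [set e | B / 2 < c e.1 e.2]) = U.
    by rewrite -setIUr; apply/setP => e; rewrite !inE leNgt orNb andbT.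
  exact: (submod_subadd (fun U => f_ge0 (vec_of_set U)) (set_utility_submod f_submod)).
(* The factor 1/16 is 1/2 from the fair coin, 1/2 from the Markov bound and 1/4 from scaling [y] to
   [y / 4]. *)
move: greedy small large split; lra.
Qed.
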